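(* Let $k>0$ and $c\in(0,1)$. The symmetric inclusion process on two sites is self-dual with duality function $D(x,n)=m(x_1,n_1)\,m(x_2,n_2)$, where $$m(x,n)=c^{\frac12(x+n)}M_n(x),\qquad x,n\in\mathbb{N}_0,$$ and $M_n(x)={}_2F_1\!\left(-n,-x;2k;1-\tfrac1c\right)$ are the Meixner polynomials. That is, with $L$ the generator of the process on two sites, $$[L D(\cdot,n)](x)=[L D(x,\cdot)](n)\qquad\text{for all } x=(x_1,x_2),\ n=(n_1,n_2)\in\mathbb{N}_0^2 .$$
   Context: $\mathbb{N}_0=\{0,1,2,\dots\}$. The symmetric inclusion process SIP($k$) on two sites is the Markov jump process on $\mathbb{N}_0^2$ with generator $$(Lf)(x_1,x_2)=x_1(2k+x_2)\left[f(x_1-1,x_2+1)-f(x_1,x_2)\right]+x_2(2k+x_1)\left[f(x_1+1,x_2-1)-f(x_1,x_2)\right],$$ where a term with vanishing rate is understood to be zero; $L$ acts pointwise on functions on $\mathbb{N}_0^2$ by this formula. A process with generator $L$ and state space $\mathcal{S}$ is called self-dual with self-duality function $D:\mathcal{S}\times\mathcal{S}\to\mathbb{R}$ if $[LD(\cdot,y)](x)=[LD(x,\cdot)](y)$ for all $x,y\in\mathcal{S}$; on the left $L$ acts on $D$ as a function of the first argument, on the right as a function of the second argument. The hypergeometric function is here the finite sum $$ {}_2F_1\!\left(-n,-x;2k;1-\tfrac1c\right)=\sum_{i=0}^{\min(n,x)}\frac{(-n)_i(-x)_i}{(2k)_i}\frac{(1-1/c)^{i}}{i!},\qquad (a)_i=a(a+1)\cdots(a+i-1),\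 (a)_0=1 .$$ *)

(* Defs.v *)
From HB Require Import structures.
From mathcomp Require Import all_boot all_order all_algebra.
From mathcomp Require Import all_classical all_reals all_analysis.

Set Implicit Arguments.
Unset Strict Implicit.
Unset Printing Implicit Defensive.

Import Order.TTheory GRing.Theory Num.Theory.
Local Open Scope ring_scope.

(* When [x.1 = 0] the truncated [x.1.-1] is harmless, since the corresponding
   rate vanishes; likewise for [x.2]. *)
Definition SIP_generator (R : realType) (k : R) (f : nat * nat -> R)
    (x : nat * nat) : R :=
  x.1%:R * (2 * k + x.2%:R) * (f (x.1.-1, x.2.+1) - f x) +
  x.2%:R * (2 * k + x.1%:R) * (f (x.1.+1, x.2.-1) - f x).

Definition self_dual (R : realType) (S : Type) (L : (S -> R) -> S -> R)
    (D : S -> S -> R) : Prop :=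
  forall x y : S, L (fun x' => D x' y) x = L (fun y' => D x y') y.

Definition pochhammer (R : realType) (a : R) (i : nat) : R :=
  \prod_(j < i) (a + j%:R).

(* The terminating series 2F1(-n, -x; b; z). *)
Definition hyp2F1 (R : realType) (n x : nat) (b z : R) : R :=
  \sum_(i < (minn n x).+1)
    pochhammer (- n%:R) i * pochhammer (- x%:R) i / pochhammer b i
      * (z ^+ i / i`!%:R).

Definition meixner (R : realType) (k c : R) (n x : nat) : R :=
  hyp2F1 n x (2 * k) (1 - 1 / c).

Definition meixner_weighted (R : realType) (k c : R) (x n : nat) : R :=
  c `^ (1 / 2 * (x%:R + n%:R)) * meixner k c n x.

Definition SIP_duality (R : realType) (k c : R) (x n : nat * nat) : R :=
  meixner_weighted k c x.1 n.1 * meixner_weighted k c x.2 n.2.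

(* Main.v *)
(* Write [t_i] for the [i]-th summand of [M_n(x)] and [T = \sum_i i t_i].
   Comparing coefficients gives the two ladder relations
     [c (2k + x) M_n(x+1) = (c (2k + x + n) - n) M_n(x) + T],
     [x M_n(x-1) = x M_n(x) - T],
   where [M_n(x)] and [T] are symmetric in [n] and [x].  They express [L D(., n)]
   at [x] as a polynomial in [x_j], [n_j], [M_{n_j}(x_j)] and [T_j], up to the
   common factor [sqrt c ^ (x_1 + n_1 + x_2 + n_2) / c]; this polynomial is
   invariant under the exchange of [x] and [n]. *)
Require Import Defs.
From HB Require Import structures.
From mathcomp Require Import all_boot all_order all_algebra.
From mathcomp Require Import all_classical all_reals all_analysis.
From mathcomp Require Import ring.

Set Implicit Arguments.
Unset Strict Implicit.
Unset Printing Implicit Defensive.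

Import Order.TTheory GRing.Theory Num.Theory.
Local Open Scope ring_scope.

Lemma pochhammer0 (R : realType) (a : R) : pochhammer a 0 = 1.
Proof. by rewrite /pochhammer big_ord0. Qed.

Lemma pochhammerS (R : realType) (a : R) i :
  pochhammer a i.+1 = pochhammer a i * (a + i%:R).
Proof. by rewrite /pochhammer big_ord_recr. Qed.

(** Both sides are $(a)_{i+1}$, with the first or the last factor split off. *)
Lemma pochhammer_shift (R : realType) (a : R) i :
  a * pochhammer (a + 1) i = pochhammer a i * (a + i%:R).
Proof.
elim: i => [|i IHi]; first by rewrite !pochhammer0; ring.
by rewrite !pochhammerS mulrA IHi; ring.
Qed.

Lemma pochhammer_pred (R : realType) (a : R) i :
  pochhammer (a - 1) i.+1 = pochhammer a i.+1 - i.+1%:R * pochhammer a i.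
Proof.
have := pochhammer_shift (a - 1) i; rewrite subrK !pochhammerS => <-.
by ring.
Qed.

Lemma pochhammer_opp_nat_eq0 (R : realType) (n i : nat) :
  (n < i)%N -> pochhammer (- n%:R : R) i = 0.
Proof.
move=> ni; rewrite /pochhammer (bigD1 (Ordinal ni)) //=.
by rewrite addNr mul0r.
Qed.

Lemma pochhammer_gt0 (R : realType) (a : R) i : 0 < a -> 0 < pochhammer a i.
Proof. by move=> a0; apply: prodr_gt0 => j _; rewrite ltr_wpDr. Qed.

Definition meixner_coef (R : realType) (k c : R) (i : nat) : R :=
  (1 - 1 / c) ^+ i / (pochhammer (2 * k) i * i`!%:R).

Definition meixner_term (R : realType) (k c : R) (n x i : nat) : R :=
  meixner_coef k c i * pochhammer (- n%:R) i * pochhammer (- x%:R) i.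

Definition meixner_moment (R : realType) (k c : R) (n x : nat) : R :=
  \sum_(i < (minn n x).+1) i%:R * meixner_term k c n x i.

(** The ratio of consecutive coefficients is $(1 - 1/c) / ((2k+i)(i+1))$; multiplying by $c$ turns
    $1 - 1/c$ into $c - 1$. *)
Lemma meixner_coefS (R : realType) (k c : R) i : 0 < k -> 0 < c ->
  (c - 1) * meixner_coef k c i =
  c * (2 * k + i%:R) * i.+1%:R * meixner_coef k c i.+1.
Proof.
move=> k0 c0; rewrite /meixner_coef pochhammerS factS exprS natrM.
have P0 : pochhammer (2 * k) i != 0.
  by rewrite gt_eqF // pochhammer_gt0 // mulr_gt0.
have F0 : i`!%:R != 0 :> R by rewrite pnatr_eq0 -lt0n fact_gt0.
have K0 : 2 * k + i%:R != 0 by rewrite gt_eqF // ltr_wpDr // mulr_gt0.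
have S0 : i.+1%:R != 0 :> R by rewrite pnatr_eq0.
have C0 : c != 0 by rewrite gt_eqF.
move: S0 K0 P0 F0; move: (i.+1%:R : R) (2 * k + i%:R) => S K.
move: (pochhammer _ _) (i`!%:R : R) ((1 - 1 / c) ^+ i) => P F W S0 K0 P0 F0.
by field; rewrite P0 F0 K0 S0 C0.
Qed.

Lemma meixner_term_eq0 (R : realType) (k c : R) (n x i : nat) :
  (minn n x < i)%N -> meixner_term k c n x i = 0.
Proof.
rewrite gtn_min /meixner_term => /orP[] /(pochhammer_opp_nat_eq0 R) ->.
  by rewrite mulr0 mul0r.
by rewrite mulr0.
Qed.

Lemma meixner_termC (R : realType) (k c : R) n x i :
  meixner_term k c n x i = meixner_term k c x n i.
Proof. exact: mulrAC. Qed.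

(** Lets the sums for $x-1$, $x$ and $x+1$ run over the common range $i \le n$. *)
Lemma meixner_sum_widen (R : realType) (k c : R) (n x N : nat) (g : nat -> R) :
  (minn n x <= N)%N ->
  \sum_(i < (minn n x).+1) g i * meixner_term k c n x i =
  \sum_(i < N.+1) g i * meixner_term k c n x i.
Proof.
move=> leN; rewrite (big_ord_widen N.+1 (fun i => g i * meixner_term k c n x i)) //.
rewrite big_mkcond /=; apply: eq_bigr => i _; case: ltnP => // lti.
by rewrite meixner_term_eq0 ?mulr0.
Qed.

Lemma meixnerE (R : realType) (k c : R) (n x N : nat) : (minn n x <= N)%N ->
  meixner k c n x = \sum_(i < N.+1) meixner_term k c n x i.
Proof.
move=> leN; have := @meixner_sum_widen R k c n x N (fun=> 1) leN.
under eq_bigr do rewrite mul1r.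
under [in RHS]eq_bigr do rewrite mul1r.
move=> <-; apply: eq_bigr => i _.
by rewrite /meixner_term /meixner_coef invfM; ring.
Qed.

Lemma meixnerC (R : realType) (k c : R) n x : meixner k c n x = meixner k c x n.
Proof.
rewrite !(@meixnerE _ _ _ _ _ (minn n x)) //; last by rewrite minnC.
by apply: eq_bigr => i _; rewrite meixner_termC.
Qed.

Lemma meixner_momentC (R : realType) (k c : R) n x :
  meixner_moment k c n x = meixner_moment k c x n.
Proof.
by rewrite /meixner_moment minnC; apply: eq_bigr => i _; rewrite meixner_termC.
Qed.

(* For [y = - n] and [N = n] the right-hand side vanishes. *)
Lemma meixner_up_telescope (R : realType) (k c y a : R) N : 0 < k -> 0 < c ->
  \sum_(i < N.+1) meixner_coef k c i * pochhammer y i *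
    (c * (2 * k - a) * pochhammer (a - 1) i -
     (c * (2 * k - a - y) + y + i%:R) * pochhammer a i) =
  (c - 1) * meixner_coef k c N * pochhammer y N.+1 * pochhammer a N.
Proof.
move=> k0 c0; elim: N => [|N IHN].
  by rewrite big_ord_recr big_ord0 /= !pochhammerS !pochhammer0; ring.
(* Now every term carries [meixner_coef k c N.+1], [pochhammer y N.+1] and [pochhammer a N]; a
   polynomial identity remains. *)
rewrite big_ord_recr IHN /= meixner_coefS // pochhammer_pred.
by rewrite (pochhammerS y N.+1) (pochhammerS a N); ring.
Qed.

Lemma meixner_up (R : realType) (k c : R) (n x : nat) : 0 < k -> 0 < c ->
  c * (2 * k + x%:R) * meixner k c n x.+1 =
  (c * (2 * k + x%:R + n%:R) - n%:R) * meixner k c n x + meixner_moment k c n x.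
Proof.
move=> k0 c0; rewrite /meixner_moment (@meixner_sum_widen _ _ _ _ _ n) ?geq_minl //.
rewrite !(@meixnerE _ _ _ _ _ n) ?geq_minl // !mulr_sumr -big_split /=.
apply/eqP; rewrite -subr_eq0 -sumrB.
(* With $a = -x$ one has $a - 1 = -(x+1)$, so the telescoping sum is the termwise difference of the
   two sides. *)
have := @meixner_up_telescope R k c (- n%:R) (- x%:R) n k0 c0.
rewrite pochhammer_opp_nat_eq0 // mulr0 mul0r => E; rewrite -[X in _ == X]E.
apply/eqP/eq_bigr => i _; rewrite /meixner_term.
have -> : - x.+1%:R = - x%:R - 1 :> R by rewrite -natr1 opprD.
by ring.
Qed.

(** Unlike [meixner_up], this holds term by term, since $x (-(x-1))_i = (x-i) (-x)_i$. *)
Lemma meixner_down (R : realType) (k c : R) (n x : nat) :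
  x%:R * meixner k c n x.-1 = x%:R * meixner k c n x - meixner_moment k c n x.
Proof.
rewrite /meixner_moment (@meixner_sum_widen _ _ _ _ _ n) ?geq_minl //.
rewrite !(@meixnerE _ _ _ _ _ n) ?geq_minl // !mulr_sumr -sumrB.
apply: eq_bigr => i _; rewrite /meixner_term.
have E : x%:R * pochhammer (- x.-1%:R) i =
         pochhammer (- x%:R) i * (x%:R - i%:R) :> R.
  have := pochhammer_shift (- x%:R : R) i.
  (* For $x = 0$ the shift identity reads $0 = i (0)_i$, so both sides vanish. *)
  case: x => [|x] /=; first by rewrite oppr0 !mul0r add0r sub0r mulrN => <-; ring.
  have -> : - x.+1%:R + 1 = - x%:R :> R by rewrite -natr1; ring.
  by move=> E; apply: oppr_inj; rewrite -mulNr E; ring.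
by rewrite mulrCA E; ring.
Qed.

Section Weighted.
Variables (R : realType) (k c : R).
Hypotheses (k0 : 0 < k) (c0 : 0 < c).

Let s : R := c `^ (1 / 2).

Let s_neq0 : s != 0. Proof. by rewrite gt_eqF // powR_gt0. Qed.

Let s_sqr : s ^+ 2 = c.
Proof.
rewrite -powR_mulrn ?powR_ge0 // -powRrM.
by rewrite (_ : 1 / 2 * 2 = 1) ?powRr1 ?ltW //; field.
Qed.

Lemma meixner_weightedE x n :
  meixner_weighted k c x n = s ^+ (x + n) * meixner k c n x.
Proof. by rewrite /meixner_weighted -natrD powRrM powR_mulrn ?powR_ge0. Qed.

(** The shift contributes a factor $s$, and removing the $c = s^2$ of [meixner_up] leaves $1/s$. A
    downward shift gives $1/s$ as well, so each jump yields $1/c$. *)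
Lemma meixner_weighted_up x n :
  (2 * k + x%:R) * meixner_weighted k c x.+1 n =
  s ^+ (x + n) / s *
  ((c * (2 * k + x%:R + n%:R) - n%:R) * meixner k c n x
   + meixner_moment k c n x).
Proof.
rewrite -meixner_up // meixner_weightedE addSn exprS.
rewrite -[X in X * (2 * k + _) * meixner _ _ _ _]s_sqr.
by field.
Qed.

Lemma meixner_weighted_down x n :
  x%:R * meixner_weighted k c x.-1 n =
  s ^+ (x + n) / s * (x%:R * meixner k c n x - meixner_moment k c n x).
Proof.
rewrite -meixner_down meixner_weightedE.
case: x => [|x] /=; first by rewrite !mul0r mulr0.
by rewrite addSn exprS; field.
Qed.

Lemma SIP_generator_duality (x n : nat * nat) :
  let M1 := meixner k c n.1 x.1 in let M2 := meixner k c n.2 x.2 in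
  let T1 := meixner_moment k c n.1 x.1 in
  let T2 := meixner_moment k c n.2 x.2 in
  SIP_generator k (fun y => SIP_duality k c y n) x =
  s ^+ (x.1 + n.1) * s ^+ (x.2 + n.2) / c *
  ((c - 1) * (n.1%:R * x.2%:R + n.2%:R * x.1%:R) * M1 * M2
   + (x.1%:R + n.1%:R - c * (2 * k + x.1%:R + n.1%:R)) * M1 * T2
   + (x.2%:R + n.2%:R - c * (2 * k + x.2%:R + n.2%:R)) * M2 * T1
   - 2 * T1 * T2).
Proof.
move=> M1 M2 T1 T2; rewrite /SIP_generator /SIP_duality /=.
pose m := meixner_weighted k c.
(* Each jump is a downward shift at one site times an upward shift at the other, and its rate splits
   accordingly. *)
transitivity
  ((x.1%:R * m x.1.-1 n.1) * ((2 * k + x.2%:R) * m x.2.+1 n.2)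
   + (x.2%:R * m x.2.-1 n.2) * ((2 * k + x.1%:R) * m x.1.+1 n.1)
   - (x.1%:R * (2 * k + x.2%:R) + x.2%:R * (2 * k + x.1%:R))
     * (m x.1 n.1 * m x.2 n.2)); first by rewrite /m; ring.
rewrite !meixner_weighted_down !meixner_weighted_up /m !meixner_weightedE.
rewrite -/M1 -/M2 -/T1 -/T2 -s_sqr.
by field.
Qed.

End Weighted.

Theorem theorem4p7 (R : realType) (k c : R) (hk : 0 < k) (hc0 : 0 < c)
    (hc1 : c < 1) :
  self_dual (SIP_generator k) (SIP_duality k c).
Proof.
move=> x n.
(* By symmetry of the duality function, the right-hand side is the left-hand side with $x$ and $n$
   exchanged. *)
have -> : (fun y => SIP_duality k c x y) = (fun y => SIP_duality k c y x).
  apply/funext => y.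
  by rewrite /SIP_duality /meixner_weighted !(addrC x.1%:R) !(addrC x.2%:R)
             (meixnerC k c y.1) (meixnerC k c y.2).
rewrite !SIP_generator_duality // !(meixnerC k c x.1) !(meixnerC k c x.2).
rewrite (meixner_momentC k c x.1) (meixner_momentC k c x.2).
by rewrite (addnC x.1) (addnC x.2); ring.
Qed.
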